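(* Let $k\geq 1$ be an integer. If $f\in\mathrm{Diff}_+^k(\mathbb{S}^1)$ has a hyperbolic periodic point, then $f$ is $C^k$-undistorted. Likewise, if $f\in\mathrm{Diff}_+^k(I)$ has a hyperbolic fixed point, then $f$ is $C^k$-undistorted.
   Context: $I=[0,1]$, and $\mathbb{S}^1$ is $[0,1]$ with endpoints identified (i.e. $\mathbb{R}/\mathbb{Z}$); derivatives are taken in the standard coordinate. For $M\in\{\mathbb{S}^1,I\}$, $\mathrm{Diff}_+^k(M)$ is the group (under composition) of orientation-preserving $C^k$ diffeomorphisms of $M$, a Polish group with the uniform $C^k$ topology. A hyperbolic periodic point of $f$ is a point $x$ with $f^q(x)=x$ and $(f^q)'(x)\ne 1$ for some positive integer $q$; a hyperbolic fixed point is a point $x$ with $f(x)=x$ and $f'(x)\neq 1$. A pseudometric $d$ on a topological group $G$ is maximal if it is continuous, right-invariant, and for every continuous right-invariant pseudometric $\rho$ on $G$ there are constants $K,C$ with $\rho\le K\cdot d+C$. Any two maximal pseudometrics on $G$ are quasi-isometrically equivalent, and the groups $\mathrm{Diff}_+^k(M)$ admit maximal pseudometrics. For $G$ with a maximal pseudometric $d$, an element $f\in G$ is distorted in $G$ if the inclusion $\langle f\rangle\hookrightarrow G$ is not a quasi-isometric embedding (with respect to a right-invariant Cayley metric on $\langle f\rangle$ and $d$ on $G$), and undistorted otherwise; this is independent of the choice of $d$. For non-torsion $f$, the limit $\lim_{n\to\infty} d(f^n,e)/n$ exists, and $f$ is distorted if and only if it equals $0$. A diffeomorphism $f$ is called $C^k$-distorted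 if it is distorted in the Polish group $\mathrm{Diff}_+^k(M)$ or is a torsion element; otherwise it is $C^k$-undistorted. *)

(* Defs.v *)
From HB Require Import structures.
From mathcomp Require Import all_boot all_order all_algebra.
From mathcomp Require Import all_classical all_reals.
From mathcomp Require Import topology normedtype derive realfun.

Set Implicit Arguments.
Unset Strict Implicit.
Unset Printing Implicit Defensive.

Import Order.TTheory GRing.Theory Num.Theory numFieldNormedType.Exports.

Local Open Scope classical_set_scope.
Local Open Scope ring_scope.
Local Open Scope quotient_scope.

(* Continuity of the group operations is not recorded: no definition below
   depends on it. *)
#[short(type="groupTopType")]
HB.structure Definition GroupTop := {G of Group G & Topological G}.

Section Distortion.
Variables (R : realType) (G : groupTopType).
Implicit Types (d rho : G -> G -> R) (f x y z : G) (m : int).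

Definition is_pseudometric d :=
  [/\ forall x, d x x = 0,
      forall x y, d x y = d y x &
      forall x y z, d x z <= d x y + d y z].

Definition right_invariant d :=
  forall x y z, d (x * z)%g (y * z)%g = d x y.

Definition continuous_right_invariant_pseudometric d :=
  [/\ is_pseudometric d, continuous (fun xy : G * G => d xy.1 xy.2) &
      right_invariant d].

Definition maximal_pseudometric d :=
  continuous_right_invariant_pseudometric d /\
  forall rho, continuous_right_invariant_pseudometric rho ->
    exists K C : R, forall x y, rho x y <= K * d x y + C.

Definition zpow f m : G :=
  match m with Posz n => (f ^+ n)%g | Negz n => (f ^- n.+1)%g end.

Definition cyclic_subgroup f : set G := range (zpow f).

(* The Cayley metric of <f> for the generating set [{f}]: the length of a
   shortest word in [f] and its inverse that represents [x * y^-1].  It is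
   right-invariant. *)
Definition cayley_dist f x y : R :=
  inf [set `|m|%N%:R | m in [set m | zpow f m = (x * y^-1)%g]].

Definition quasi_isometric_embedding (X Y : Type) (dX : X -> X -> R)
    (dY : Y -> Y -> R) (phi : X -> Y) :=
  exists K C : R, [/\ 1 <= K, 0 <= C & forall a b,
    K^-1 * dX a b - C <= dY (phi a) (phi b) <= K * dX a b + C].

Definition distorted d f :=
  ~ quasi_isometric_embedding
      (fun a b : cyclic_subgroup f => cayley_dist f (\val a) (\val b)) d
      (fun a : cyclic_subgroup f => \val a).

Definition torsion f := exists2 n, (0 < n)%N & (f ^+ n)%g = 1%g.

(* To be used with [G] a group of C^k diffeomorphisms and [d] any maximal
   pseudometric on it. *)
Definition Ck_distorted d f := distorted d f \/ torsion f.

Definition Ck_undistorted d f := ~ Ck_distorted d f.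

End Distortion.

Section DerivOn.
Variables (R : realType) (A : set R).
Implicit Types (f g : R -> R) (x : R).

(* For [A = `[0, 1]] these are one-sided at the endpoints; [deriv_onT] below
   relates the case [A = setT] to the derivative of the library. *)
Definition is_deriv_on f x (l : R) :=
  (f y - f x) / (y - x) @[y --> within A x^'] --> l.

Definition derivable_on f x := exists l, is_deriv_on f x l.

Definition deriv_on f x : R :=
  lim ((f y - f x) / (y - x) @[y --> within A x^']).

Definition derivn_on n f : R -> R := iter n deriv_on f.

Definition Ck_on k f :=
  (forall j x, (j < k)%N -> A x -> derivable_on (derivn_on j f) x) /\
  {within A, continuous (derivn_on k f)}.

Lemma Ck_on0 f : Ck_on 0 f <-> {within A, continuous f}.
Proof. by split=> [[]|]. Qed.

Lemma Ck_onS k f :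
  Ck_on k.+1 f <-> (forall x, A x -> derivable_on f x) /\ Ck_on k (deriv_on f).
Proof.
rewrite /Ck_on /derivn_on; split=> [[df cf]|[df [ddf cf]]].
  split; first by move=> x Ax; exact: (df 0%N).
  by split=> [j x jk Ax|]; [have := df j.+1 x jk Ax|]; rewrite -?iterSr.
split=> [[|j] x jk Ax|]; rewrite ?iterSr//; first exact: df.
exact: ddf.
Qed.

Lemma is_deriv_on_ext f g x l : {in A, f =1 g} -> A x ->
  is_deriv_on f x l -> is_deriv_on g x l.
Proof.
move=> fg Ax; apply: cvg_trans; apply: near_eq_cvg.
near=> y; rewrite !fg ?inE//.
by near: y; exact: withinT.
Unshelve. all: by end_near. Qed.

Lemma is_deriv_on_id x : is_deriv_on id x 1.
Proof.
apply: cvg_near_cst.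
by exists 1 => //= y _ yx Ay; rewrite divff// subr_eq0.
Qed.

Lemma is_deriv_on_cst (c x : R) : is_deriv_on (cst c) x 0.
Proof.
by apply: cvg_near_cst; exists 1 => //= y _ _ _; rewrite /cst subrr mul0r.
Qed.

(* Caratheodory's slope function *)
Lemma is_deriv_onP f x l : is_deriv_on f x l <->
  (exists2 phi : R -> R, phi y @[y --> within A (nbhs x)] --> phi x &
     phi x = l /\ forall y, f y - f x = phi y * (y - x)).
Proof.
split=> [fl|[phi cphi [<- fphi]]].
  exists (fun y => if y == x then l else (f y - f x) / (y - x)).
    rewrite eqxx; apply/cvgrPdist_lt => e e0.
    move/cvgrPdist_lt : fl => /(_ e e0) [d /= d0 fd].
    exists d => //= y yd Ay; case: eqVneq => [_|yx]; first by rewrite subrr normr0.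
    exact: fd.
  rewrite eqxx; split=> // y; case: eqVneq => [->|yx]; first by rewrite !subrr mulr0.
  by rewrite divfK// subr_eq0.
apply/cvgrPdist_lt => e e0; move/cvgrPdist_lt : cphi => /(_ e e0) [d /= d0 phid].
exists d => //= y yd yx Ay; rewrite fphi mulfK ?subr_eq0//.
exact: phid.
Qed.

Lemma is_deriv_on_cvg f x l : is_deriv_on f x l ->
  f y @[y --> within A (nbhs x)] --> f x.
Proof.
move=> /is_deriv_onP[phi cphi [_ fphi]].
have : phi y * (y - x) + f x @[y --> within A (nbhs x)] -->
    phi x * (x - x) + f x.
  apply: cvgD; last exact: cvg_cst.
  apply: cvgM => //; apply: cvgB; last exact: cvg_cst.
  exact: cvg_within.
by rewrite subrr mulr0 add0r; under eq_fun do rewrite -fphi subrK.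
Qed.

Lemma is_deriv_onD f g x a b : is_deriv_on f x a -> is_deriv_on g x b ->
  is_deriv_on (fun y => f y + g y) x (a + b).
Proof.
move=> fa gb; rewrite /is_deriv_on.
under eq_fun do rewrite opprD addrACA mulrDl.
exact: cvgD.
Qed.

Lemma is_deriv_onM f g x a b : is_deriv_on f x a -> is_deriv_on g x b ->
  is_deriv_on (fun y => f y * g y) x (a * g x + f x * b).
Proof.
move=> /[dup] fa /is_deriv_onP[phi cphi [phix fphi]].
move=> /[dup] gb /is_deriv_onP[psi cpsi [psix gpsi]].
apply/is_deriv_onP; exists (fun y => phi y * g y + f x * psi y).
  apply: cvgD; last by apply: cvgM => //; exact: cvg_cst.
  by apply: cvgM => //; exact: is_deriv_on_cvg gb.
rewrite phix psix; split=> // y.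
have -> : f y * g y - f x * g x = (f y - f x) * g y + f x * (g y - g x).
  by rewrite mulrBl mulrBr addrA subrK.
by rewrite fphi gpsi mulrDl mulrAC mulrA.
Qed.

Lemma is_deriv_on_comp f g x a b : (forall y, A y -> A (g y)) ->
  is_deriv_on f (g x) a -> is_deriv_on g x b ->
  is_deriv_on (f \o g) x (a * b).
Proof.
move=> Ag /is_deriv_onP[phi cphi [phix fphi]].
move=> /[dup] gb /is_deriv_onP[psi cpsi [psix gpsi]].
apply/is_deriv_onP; exists (fun y => phi (g y) * psi y).
  apply: cvgM => //; apply: cvg_trans cphi => P /= Pphi.
  have := is_deriv_on_cvg gb Pphi; rewrite /= !nbhs_filterE /within /=.
  by apply: filterS => y Py Ay; exact: Py (Ag _ Ay).
by rewrite phix psix; split=> // y /=; rewrite fphi gpsi mulrA.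
Qed.

Hypothesis A_perfect : forall x, A x -> ProperFilter (within A x^').

Lemma deriv_onE f x l : A x -> is_deriv_on f x l -> deriv_on f x = l.
Proof. by move=> Ax fl; have := A_perfect Ax => ?; exact: cvg_lim fl. Qed.

Lemma deriv_onP f x : A x -> derivable_on f x -> is_deriv_on f x (deriv_on f x).
Proof. by move=> Ax [l fl]; rewrite (deriv_onE Ax fl). Qed.

Lemma Ck_on_ext k f g : {in A, f =1 g} -> Ck_on k f -> Ck_on k g.
Proof.
elim: k => [|k IH] in f g *.
  move=> fg /Ck_on0 cf; apply/Ck_on0.
  apply/subspace_continuousP => x Ax.
  rewrite [X in _ --> X](_ : _ = f x); last by rewrite fg ?inE.
  move/subspace_continuousP : cf => /(_ x Ax); apply: cvg_trans.
  apply: near_eq_cvg; near=> y; apply: fg; rewrite inE.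
  by near: y; exact: withinT.
move=> fg /Ck_onS[df cf]; apply/Ck_onS; split.
  by move=> x Ax; have [l fl] := df x Ax; exists l; exact: is_deriv_on_ext fl.
apply: IH cf => x /[!inE] Ax; apply/esym/deriv_onE => //.
exact: is_deriv_on_ext (deriv_onP Ax (df x Ax)).
Unshelve. all: by end_near. Qed.

Lemma Ck_on_continuous k f : Ck_on k f -> {within A, continuous f}.
Proof.
case: k => [/Ck_on0//|k /Ck_onS[df _]].
apply/subspace_continuousP => x Ax; have [l fl] := df x Ax.
exact: is_deriv_on_cvg fl.
Qed.

Lemma Ck_onW k f : Ck_on k.+1 f -> Ck_on k f.
Proof.
elim: k => [|k IH] in f *; first by move=> /Ck_on_continuous /Ck_on0.
by move=> /Ck_onS[df cf]; apply/Ck_onS; split=> //; exact: IH.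
Qed.

Lemma Ck_on_cst k (c : R) : Ck_on k (cst c).
Proof.
elim: k => [|k IH] in c *; first by apply/Ck_on0 => x; exact: cvg_cst.
apply/Ck_onS; split; first by move=> x _; exists 0; exact: is_deriv_on_cst.
apply: Ck_on_ext (IH 0) => x /[!inE] Ax.
by apply/esym/deriv_onE => //; exact: is_deriv_on_cst.
Qed.

Lemma Ck_on_id k : Ck_on k id.
Proof.
case: k => [|k].
  apply/Ck_on0/subspace_continuousP => x Ax; exact: cvg_within.
apply/Ck_onS; split; first by move=> x _; exists 1; exact: is_deriv_on_id.
apply: Ck_on_ext (Ck_on_cst k 1) => x /[!inE] Ax.
by apply/esym/deriv_onE => //; exact: is_deriv_on_id.
Qed.

Lemma Ck_onD k f g : Ck_on k f -> Ck_on k g -> Ck_on k (fun x => f x + g x).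
Proof.
elim: k => [|k IH] in f g *.
  move=> /Ck_on0 cf /Ck_on0 cg; apply/Ck_on0 => x.
  by apply: cvgD; [exact: cf|exact: cg].
move=> /Ck_onS[df cf] /Ck_onS[dg cg]; apply/Ck_onS.
have dfg x : A x ->
    is_deriv_on (fun x => f x + g x) x (deriv_on f x + deriv_on g x).
  by move=> Ax; apply: is_deriv_onD; apply: deriv_onP => //; auto.
split; first by move=> x /dfg; eexists; eauto.
by apply: Ck_on_ext (IH _ _ cf cg) => x /[!inE] Ax; apply/esym/deriv_onE; auto.
Qed.

Lemma Ck_onM k f g : Ck_on k f -> Ck_on k g -> Ck_on k (fun x => f x * g x).
Proof.
elim: k => [|k IH] in f g *.
  move=> /Ck_on0 cf /Ck_on0 cg; apply/Ck_on0 => x.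
  by apply: cvgM; [exact: cf|exact: cg].
move=> Cf Cg; have [df cf] := (Ck_onS _ _).1 Cf.
have [dg cg] := (Ck_onS _ _).1 Cg; apply/Ck_onS.
have dfg x : A x -> is_deriv_on (fun x => f x * g x) x
    (deriv_on f x * g x + f x * deriv_on g x).
  by move=> Ax; apply: is_deriv_onM; apply: deriv_onP => //; auto.
split; first by move=> x /dfg; eexists; eauto.
apply: Ck_on_ext (Ck_onD (IH _ _ cf (Ck_onW Cg)) (IH _ _ (Ck_onW Cf) cg)).
by move=> x /[!inE] Ax; apply/esym/deriv_onE; auto.
Qed.

Lemma Ck_on_comp k f g : (forall y, A y -> A (g y)) ->
  Ck_on k f -> Ck_on k g -> Ck_on k (f \o g).
Proof.
move=> Ag; elim: k => [|k IH] in f *.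
  move=> /Ck_on0/subspace_continuousP cf /Ck_on0/subspace_continuousP cg.
  apply/Ck_on0/subspace_continuousP => x Ax.
  apply: cvg_trans (cf _ (Ag _ Ax)) => P /= Pf.
  have := cg _ Ax _ Pf; rewrite /= !nbhs_filterE /within /=.
  by apply: filterS => y Py Ay; exact: Py (Ag _ Ay).
move=> /Ck_onS[df cf] Cg; have [dg cg] := (Ck_onS _ _).1 Cg; apply/Ck_onS.
have dfg x : A x ->
    is_deriv_on (f \o g) x ((deriv_on f \o g) x * deriv_on g x).
  by move=> Ax; apply: is_deriv_on_comp => //; apply: deriv_onP => //; auto.
split; first by move=> x /dfg; eexists; eauto.
apply: Ck_on_ext (Ck_onM (IH _ cf (Ck_onW Cg)) cg) => x /[!inE] Ax.
by apply/esym/deriv_onE; auto.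
Qed.

End DerivOn.

Lemma setT_perfect (R : realType) (x : R) : [set: R] x ->
  ProperFilter (within [set: R] x^').
Proof. by move=> _; rewrite withinET; exact: Proper_dnbhs_numFieldType. Qed.

Lemma deriv_onT (R : realType) : @deriv_on R setT = @derive1 R R.
Proof.
apply/funext => f; apply/funext => x; rewrite /deriv_on /derive1 withinET.
congr (lim _); apply/seteqP; split=> P [e /= e0 eP]; exists e => //= y ye y0.
  have := eP (y + x); rewrite /= opprD addrCA subrr addr0 addrK mulrC; apply.
    by move: ye; rewrite /= sub0r.
  by rewrite -subr_eq0 addrK.
have := eP (y - x); rewrite /= sub0r normrN distrC subrK mulrC; apply => //.
by rewrite subr_eq0.
Qed.

Lemma unit_itv_perfect (R : realType) (x : R) : `[0, 1]%classic x ->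
  ProperFilter (within `[0, 1]%classic x^').
Proof.
rewrite /= in_itv/= => /andP[x0 x1]; apply: Build_ProperFilter_ex => P.
move=> [e /= e0 eP]; set h := Num.min (e / 2) (1 / 2) : R.
have h0 : 0 < h by rewrite lt_min !divr_gt0.
have he : h < e.
  by rewrite gt_min ltr_pdivrMr// mulr_natr mulr2n ltrDl e0.
have h2 : h <= 1 / 2 by rewrite ge_min lexx orbT.
have [xle|xgt] := leP x (1 / 2).
  exists (x + h); apply: eP => /=.
  - by rewrite opprD addNKr normrN gtr0_norm.
  - by rewrite -subr_eq0 addrAC subrr add0r gt_eqF.
  - rewrite in_itv/=; apply/andP; split; first by rewrite addr_ge0// ltW.
    by rewrite [leRHS](splitr 1) lerD.
exists (x - h); apply: eP => /=.
- by rewrite opprB addrC subrK gtr0_norm.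
- by rewrite -subr_eq0 addrAC subrr add0r oppr_eq0 gt_eqF.
- rewrite in_itv/=; apply/andP; split.
    by rewrite subr_ge0 (le_trans h2)// ltW.
  by rewrite lerBlDr (le_trans x1)// lerDl ltW.
Qed.

Definition integers (R : realType) : {pred R} := fun x => x \is a Num.int.

Lemma integers_zmod_closed (R : realType) : zmod_closed (@integers R).
Proof.
by split=> [|x y xZ yZ]; rewrite -topredE/= /integers ?rpred0// rpredB.
Qed.

HB.instance Definition _ (R : realType) :=
  GRing.isZmodClosed.Build R (@integers R) (@integers_zmod_closed R).

Definition circle (R : realType) := Quotient.quot (@integers R).

Section CircleMaps.
Variable R : realType.
Implicit Types (F G : R -> R) (f g : circle R -> circle R).

Definition is_lift F f :=
  continuous F /\ forall t, f (\pi_(circle R) t) = \pi_(circle R) (F t).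

Definition Ck_circle k f := exists2 F, is_lift F f & Ck_on setT k F.

Definition orientation_preserving_circle f :=
  exists2 F, is_lift F f & {homo F : s t / s < t}.

Definition circle_lift f : R -> R := get [set F | is_lift F f].

(* Only meant for [0 < j] and for maps that have a lift; by [is_lift_unique]
   the choice of the lift is then irrelevant, and so is that of the
   representative of [x]. *)
Definition deriv_circle j f (x : circle R) : R := derive1n j (circle_lift f) (repr x).

Lemma pi_circleP (s t : R) :
  \pi_(circle R) s = \pi_(circle R) t <-> s - t \is a Num.int.
Proof.
split=> [/eqP|st]; first by rewrite -Quotient.idealrBE.
by apply/eqP; rewrite -Quotient.idealrBE.
Qed.

Lemma pi_circle0 : \pi_(circle R) 0 = 0.
Proof. by rewrite !piE. Qed.

Lemma pi_circleD (s t : R) :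
  \pi_(circle R) (s + t) = \pi_(circle R) s + \pi_(circle R) t.
Proof. by rewrite !piE. Qed.

Lemma continuous_int_cst F : continuous F -> (forall t, F t \is a Num.int) ->
  forall s t, F s = F t.
Proof.
move=> cF ZF.
suff H s t : s <= t -> F s = F t.
  by move=> s t; have [/H//|/ltW/H] := leP s t.
move=> st; apply/eqP/negPn/negP => Fst.
wlog Flt : F cF ZF Fst / F s < F t.
  move=> H; have [|Fts|Fe] := ltgtP (F s) (F t); first exact: (H F).
    apply: (H (fun x => - F x)); rewrite ?ltrN2// ?eqr_opp//.
      by move=> x; apply: cvgN; exact: cF.
    by move=> x; rewrite rpredN.
  by rewrite Fe eqxx in Fst.
have Z2 : (1 / 2 : R) \isn't a Num.int.
  apply/negP => /intrP[m m2].
  have := ltr_int R 0 m; have := ltr_int R m 1; rewrite -!m2.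
  rewrite divr_gt0// ltr_pdivrMr// mul1r ltr1n => /esym m1 /esym m0.
  by case: m m0 m1 {m2} => // -[].
have Flt1 : F s + 1 <= F t.
  have /intrP[a Fs] := ZF s; have /intrP[b Ft] := ZF t.
  by move: Flt; rewrite Fs Ft ltr_int -lezD1 -(ler_int R) intrD.
have [||c _ Fc] := @IVT _ F s t (F s + 1 / 2) st.
- exact: continuous_subspaceT.
- rewrite (min_idPl (ltW Flt)) (max_idPr (ltW Flt)) lerDl divr_ge0//=.
  by rewrite (le_trans _ Flt1)// lerD2l ler_pdivrMr// mul1r ler1n.
- move/negP: Z2; apply; rewrite -[_ / _](addKr (F s)) -Fc.
  by rewrite rpredD// rpredN.
Qed.

Lemma is_lift_unique F G f : is_lift F f -> is_lift G f ->
  exists m : int, forall t, F t = G t + m%:~R.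
Proof.
move=> [cF Ff] [cG Gf].
have FGZ t : F t - G t \is a Num.int by apply/pi_circleP; rewrite -Ff -Gf.
have cFG : continuous (fun t => F t - G t).
  by move=> t; apply: cvgB; [exact: cF|exact: cG].
have /intrP[m m0] := FGZ 0; exists m => t; rewrite -m0.
by rewrite (continuous_int_cst cFG FGZ 0 t) addrC subrK.
Qed.

End CircleMaps.

Section CircleDiffeo.
Variables (R : realType) (k : nat).

Record diffeo_circle := DiffeoCircle {
  circle_fun :> circle R -> circle R;
  circle_inv : circle R -> circle R;
  circle_funK : cancel circle_fun circle_inv;
  circle_invK : cancel circle_inv circle_fun;
  circle_fun_Ck : Ck_circle k circle_fun;
  circle_inv_Ck : Ck_circle k circle_inv;
  circle_fun_or : orientation_preserving_circle circle_fun }.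

Lemma diffeo_circleP (f g : diffeo_circle) : (f : _ -> _) =1 g -> f = g.
Proof.
case: f g => [f f' fK f'K Cf Cf' of_] [g g' gK g'K Cg Cg' og] /= /funext fg.
subst g.
have gf : g' = f' by apply/funext => x; rewrite -[LHS]fK g'K.
subst g'.
by congr DiffeoCircle; exact: Prop_irrelevance.
Qed.

Lemma is_lift_comp F G (f g : circle R -> circle R) :
  is_lift F f -> is_lift G g -> is_lift (F \o G) (f \o g).
Proof.
move=> [cF Ff] [cG Gg]; split=> [t|t] /=; last by rewrite Gg Ff.
by apply: continuous_comp; [exact: cG|exact: cF].
Qed.

Lemma is_lift_id : is_lift id (@id (circle R)).
Proof. by split=> // t; exact: cvg_id. Qed.

Lemma Ck_circle_comp (f g : circle R -> circle R) :
  Ck_circle k f -> Ck_circle k g -> Ck_circle k (f \o g).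
Proof.
move=> [F Ff CF] [G Gg CG]; exists (F \o G); first exact: is_lift_comp.
exact: (Ck_on_comp (@setT_perfect R)).
Qed.

Lemma Ck_circle_id : Ck_circle k (@id (circle R)).
Proof.
by exists id; [exact: is_lift_id|exact: (Ck_on_id (@setT_perfect R))].
Qed.

Lemma orientation_preserving_circle_comp (f g : circle R -> circle R) :
  orientation_preserving_circle f -> orientation_preserving_circle g ->
  orientation_preserving_circle (f \o g).
Proof.
move=> [F Ff iF] [G Gg iG]; exists (F \o G); first exact: is_lift_comp.
by move=> s t st; apply: iF; exact: iG.
Qed.

Lemma orientation_preserving_circle_id :
  orientation_preserving_circle (@id (circle R)).
Proof. by exists id => //; exact: is_lift_id. Qed.

Lemma orientation_preserving_circle_inv (f : diffeo_circle) :
  orientation_preserving_circle (circle_inv f).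
Proof.
have [F Ff iF] := circle_fun_or f; have [G Gf _] := circle_inv_Ck f.
exists G => //; have [m FG] : exists m : int, forall t, F (G t) = t + m%:~R.
  apply: (@is_lift_unique _ (F \o G) id (circle_fun f \o circle_inv f)).
    exact: is_lift_comp.
  by split=> [t|t /=]; [exact: cvg_id|rewrite circle_invK].
move=> s t st; rewrite ltNge; apply/negP; rewrite le_eqVlt => /orP[/eqP Gst|].
  by move: st; rewrite -(ltrD2r m%:~R) -!FG Gst ltxx.
by move=> /iF; rewrite !FG ltrD2r => /lt_trans/(_ st); rewrite ltxx.
Qed.

Definition diffeo_circle_one : diffeo_circle :=
  DiffeoCircle (fun=> erefl) (fun=> erefl) Ck_circle_id Ck_circle_id
    orientation_preserving_circle_id.

Definition diffeo_circle_mul (f g : diffeo_circle) : diffeo_circle :=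
  @DiffeoCircle (f \o g) (circle_inv g \o circle_inv f)
    (can_comp (circle_funK f) (circle_funK g))
    (can_comp (circle_invK g) (circle_invK f))
    (Ck_circle_comp (circle_fun_Ck f) (circle_fun_Ck g))
    (Ck_circle_comp (circle_inv_Ck g) (circle_inv_Ck f))
    (orientation_preserving_circle_comp (circle_fun_or f) (circle_fun_or g)).

Definition diffeo_circle_inv (f : diffeo_circle) : diffeo_circle :=
  DiffeoCircle (circle_invK f) (circle_funK f) (circle_inv_Ck f)
    (circle_fun_Ck f) (orientation_preserving_circle_inv f).

HB.instance Definition _ := gen_eqMixin diffeo_circle.
HB.instance Definition _ := gen_choiceMixin diffeo_circle.

Lemma diffeo_circle_mulA : associative diffeo_circle_mul.
Proof. by move=> f g h; exact: diffeo_circleP. Qed.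

Lemma diffeo_circle_mul1 : left_id diffeo_circle_one diffeo_circle_mul.
Proof. by move=> f; exact: diffeo_circleP. Qed.

Lemma diffeo_circle_1mul : right_id diffeo_circle_one diffeo_circle_mul.
Proof. by move=> f; exact: diffeo_circleP. Qed.

Lemma diffeo_circle_mulV :
  left_inverse diffeo_circle_one diffeo_circle_inv diffeo_circle_mul.
Proof. by move=> f; apply: diffeo_circleP => x; exact: circle_funK. Qed.

Lemma diffeo_circle_Vmul :
  right_inverse diffeo_circle_one diffeo_circle_inv diffeo_circle_mul.
Proof. by move=> f; apply: diffeo_circleP => x; exact: circle_invK. Qed.

HB.instance Definition _ := isGroup.Build diffeo_circle diffeo_circle_mulA
  diffeo_circle_mul1 diffeo_circle_1mul diffeo_circle_mulV diffeo_circle_Vmul.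

(* The first clause says that [f x] and [g x] are at distance less than [e]
   in R/Z. *)
Definition diffeo_circle_ball (f : diffeo_circle) (e : R) (g : diffeo_circle) :=
  (forall x, exists2 t, `|t| < e & g x = f x + \pi_(circle R) t) /\
  (forall j x, (0 < j <= k)%N ->
     `|deriv_circle j f x - deriv_circle j g x| < e).

Lemma diffeo_circle_ball_center f (e : R) : 0 < e -> diffeo_circle_ball f e f.
Proof.
move=> e0; split=> [x|j x _]; last by rewrite subrr normr0.
by exists 0; rewrite ?normr0// pi_circle0 addr0.
Qed.

Lemma diffeo_circle_ball_sym f g (e : R) :
  diffeo_circle_ball f e g -> diffeo_circle_ball g e f.
Proof.
move=> [fg dfg]; split=> [x|j x jk]; last by rewrite distrC dfg.
have [t te ->] := fg x; exists (- t); rewrite ?normrN//.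
by rewrite -addrA -pi_circleD subrr pi_circle0 addr0.
Qed.

Lemma diffeo_circle_ball_triangle f g h (e1 e2 : R) :
  diffeo_circle_ball f e1 g -> diffeo_circle_ball g e2 h ->
  diffeo_circle_ball f (e1 + e2) h.
Proof.
move=> [fg dfg] [gh dgh]; split=> [x|j x jk].
  have [s se gE] := fg x; have [t te ->] := gh x; exists (s + t).
    by rewrite (le_lt_trans (ler_normD _ _))// ltrD.
  by rewrite gE -addrA -pi_circleD.
rewrite (le_lt_trans (ler_distD (deriv_circle j g x) _ _))//.
by rewrite ltrD// (dfg, dgh).
Qed.

HB.instance Definition _ :=
  hasNbhs.Build diffeo_circle (nbhs_ (entourage_ diffeo_circle_ball)).
HB.instance Definition _ := @Nbhs_isPseudoMetric.Build R diffeo_circle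
  (entourage_ diffeo_circle_ball) erefl diffeo_circle_ball
  diffeo_circle_ball_center diffeo_circle_ball_sym diffeo_circle_ball_triangle
  erefl.

End CircleDiffeo.

Definition unit_interval (R : realType) := {x : R | 0 <= x <= 1}.

Lemma unit_interval0_subproof (R : realType) : 0 <= (0 : R) <= 1.
Proof. by rewrite lexx ler01. Qed.

Definition unit_interval0 (R : realType) : unit_interval R :=
  exist _ 0 (@unit_interval0_subproof R).

Section IntervalMaps.
Variable R : realType.
Implicit Types f g : unit_interval R -> unit_interval R.

(* The values outside [0, 1] are irrelevant: only derivatives relative to
   [0, 1] are taken. *)
Definition extend f : R -> R := fun t => \val (f (insubd (unit_interval0 R) t)).

Definition Ck_interval k f := Ck_on `[0, 1] k (extend f).

Definition orientation_preserving_interval f :=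
  {homo f : x y / \val x < \val y}.

Definition deriv_interval j f (x : unit_interval R) : R :=
  derivn_on `[0, 1] j (extend f) (\val x).

End IntervalMaps.

Section IntervalDiffeo.
Variables (R : realType) (k : nat).

Record diffeo_interval := DiffeoInterval {
  interval_fun :> unit_interval R -> unit_interval R;
  interval_inv : unit_interval R -> unit_interval R;
  interval_funK : cancel interval_fun interval_inv;
  interval_invK : cancel interval_inv interval_fun;
  interval_fun_Ck : Ck_interval k interval_fun;
  interval_inv_Ck : Ck_interval k interval_inv;
  interval_fun_or : orientation_preserving_interval interval_fun }.

Lemma diffeo_intervalP (f g : diffeo_interval) : (f : _ -> _) =1 g -> f = g.
Proof.
case: f g => [f f' fK f'K Cf Cf' of_] [g g' gK g'K Cg Cg' og] /= /funext fg.
subst g.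
have gf : g' = f' by apply/funext => x; rewrite -[LHS]fK g'K.
subst g'.
by congr DiffeoInterval; exact: Prop_irrelevance.
Qed.

Lemma extend_comp (f g : unit_interval R -> unit_interval R) :
  extend (f \o g) = extend f \o extend g.
Proof. by apply/funext => t; rewrite /extend /= valKd. Qed.

Lemma Ck_interval_comp (f g : unit_interval R -> unit_interval R) :
  Ck_interval k f -> Ck_interval k g -> Ck_interval k (f \o g).
Proof.
rewrite /Ck_interval extend_comp; apply: (Ck_on_comp (@unit_itv_perfect R)) => y _.
by rewrite /= in_itv/= /extend; exact: (valP (g _)).
Qed.

Lemma Ck_interval_id : Ck_interval k (@id (unit_interval R)).
Proof.
have Pf := @unit_itv_perfect R; apply: (Ck_on_ext Pf _ (Ck_on_id Pf k)) => y.
by rewrite inE/= in_itv/= => y01; rewrite /extend insubdK.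
Qed.

Lemma orientation_preserving_interval_inv (f : diffeo_interval) :
  orientation_preserving_interval (interval_inv f).
Proof.
move=> x y xy; rewrite ltNge; apply/negP; rewrite le_eqVlt => /orP[/eqP|].
  by move=> /val_inj/(can_inj (interval_invK f)) yx; rewrite yx ltxx in xy.
move=> /(interval_fun_or f); rewrite !interval_invK => /lt_trans/(_ xy).
by rewrite ltxx.
Qed.

Definition diffeo_interval_one : diffeo_interval :=
  @DiffeoInterval id id (fun=> erefl) (fun=> erefl) Ck_interval_id
    Ck_interval_id (fun x y xy => xy).

Definition diffeo_interval_mul (f g : diffeo_interval) : diffeo_interval :=
  @DiffeoInterval (f \o g) (interval_inv g \o interval_inv f)
    (can_comp (interval_funK f) (interval_funK g))
    (can_comp (interval_invK g) (interval_invK f))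
    (Ck_interval_comp (interval_fun_Ck f) (interval_fun_Ck g))
    (Ck_interval_comp (interval_inv_Ck g) (interval_inv_Ck f))
    (fun x y xy => interval_fun_or f (interval_fun_or g xy)).

Definition diffeo_interval_inv (f : diffeo_interval) : diffeo_interval :=
  DiffeoInterval (interval_invK f) (interval_funK f) (interval_inv_Ck f)
    (interval_fun_Ck f) (@orientation_preserving_interval_inv f).

HB.instance Definition _ := gen_eqMixin diffeo_interval.
HB.instance Definition _ := gen_choiceMixin diffeo_interval.

Lemma diffeo_interval_mulA : associative diffeo_interval_mul.
Proof. by move=> f g h; exact: diffeo_intervalP. Qed.

Lemma diffeo_interval_mul1 : left_id diffeo_interval_one diffeo_interval_mul.
Proof. by move=> f; exact: diffeo_intervalP. Qed.

Lemma diffeo_interval_1mul : right_id diffeo_interval_one diffeo_interval_mul.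
Proof. by move=> f; exact: diffeo_intervalP. Qed.

Lemma diffeo_interval_mulV :
  left_inverse diffeo_interval_one diffeo_interval_inv diffeo_interval_mul.
Proof. by move=> f; apply: diffeo_intervalP => x; exact: interval_funK. Qed.

Lemma diffeo_interval_Vmul :
  right_inverse diffeo_interval_one diffeo_interval_inv diffeo_interval_mul.
Proof. by move=> f; apply: diffeo_intervalP => x; exact: interval_invK. Qed.

HB.instance Definition _ := isGroup.Build diffeo_interval diffeo_interval_mulA
  diffeo_interval_mul1 diffeo_interval_1mul diffeo_interval_mulV
  diffeo_interval_Vmul.

Definition diffeo_interval_ball (f : diffeo_interval) (e : R)
    (g : diffeo_interval) :=
  forall j x, (j <= k)%N -> `|deriv_interval j f x - deriv_interval j g x| < e.

Lemma diffeo_interval_ball_center f (e : R) :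
  0 < e -> diffeo_interval_ball f e f.
Proof. by move=> e0 j x _; rewrite subrr normr0. Qed.

Lemma diffeo_interval_ball_sym f g (e : R) :
  diffeo_interval_ball f e g -> diffeo_interval_ball g e f.
Proof. by move=> fg j x jk; rewrite distrC fg. Qed.

Lemma diffeo_interval_ball_triangle f g h (e1 e2 : R) :
  diffeo_interval_ball f e1 g -> diffeo_interval_ball g e2 h ->
  diffeo_interval_ball f (e1 + e2) h.
Proof.
move=> fg gh j x jk.
rewrite (le_lt_trans (ler_distD (deriv_interval j g x) _ _))//.
by rewrite ltrD// (fg, gh).
Qed.

HB.instance Definition _ :=
  hasNbhs.Build diffeo_interval (nbhs_ (entourage_ diffeo_interval_ball)).
HB.instance Definition _ := @Nbhs_isPseudoMetric.Build R diffeo_interval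
  (entourage_ diffeo_interval_ball) erefl diffeo_interval_ball
  diffeo_interval_ball_center diffeo_interval_ball_sym
  diffeo_interval_ball_triangle erefl.

End IntervalDiffeo.

Definition hyperbolic_periodic_point (R : realType) (k : nat)
    (f : diffeo_circle R k) (x : circle R) :=
  exists q, [/\ (0 < q)%N, (f ^+ q)%g x = x & deriv_circle 1 (f ^+ q)%g x != 1].

Definition hyperbolic_fixed_point (R : realType) (k : nat)
    (f : diffeo_interval R k) (x : unit_interval R) :=
  f x = x /\ deriv_interval 1 f x != 1.

(* Main.v *)
(* The logarithmic derivative L g x = ln (g' x) is an additive cocycle,
   L (g h) x = L g (h x) + L h x, so that sup_x |L g x - L h x| is a continuous
   right-invariant pseudometric: the cocycle identity makes the terms in L z
   cancel in the distance from g z to h z.  If f^q fixes x then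
   L (f^(q n)) x = n L (f^q) x, so at a hyperbolic point the distance from
   f^(q n) to the identity grows linearly in n.  A maximal pseudometric
   dominates this one up to affine constants, hence grows linearly along the
   powers of f as well. *)
Require Import Defs.
From mathcomp Require Import all_boot all_order all_algebra.
From mathcomp Require Import all_classical all_reals.
From mathcomp Require Import topology normedtype derive realfun exp.
From mathcomp Require Import lra.

Set Implicit Arguments.
Unset Strict Implicit.
Unset Printing Implicit Defensive.

Import Order.TTheory GRing.Theory Num.Theory numFieldNormedType.Exports.

Local Open Scope classical_set_scope.
Local Open Scope ring_scope.
Local Open Scope quotient_scope.

(** * Integer powers in the cyclic subgroup *)

Section CyclicSubgroup.
Variables (R : realType) (G : groupTopType) (f : G).

(** Writing exponents as differences of naturals avoids splitting on signs when powers are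
    multiplied. *)
Lemma zpow_sub m n : zpow f (m%:Z - n%:Z) = (f ^+ m * f ^- n)%g.
Proof.
have [nm|mn] := leqP n m.
  by rewrite subzn//= expgnFr.
rewrite -opprB subzn ?(ltnW mn)//.
have : (0 < n - m)%N by rewrite subn_gt0.
case E : (n - m)%N => [//|p] _.
by rewrite -NegzE /= -E expgnFr ?(ltnW mn)// invgF.
Qed.

(** Guarantees that the set of exponents in [cayley_dist] is nonempty, so that its [inf] is a true
    infimum. *)
Lemma cyclic_subgroup_div x y :
  cyclic_subgroup f x -> cyclic_subgroup f y -> cyclic_subgroup f (x * y^-1)%g.
Proof.
have intE (m : int) : exists i j : nat, m = i%:Z - j%:Z.
  by case: m => n; [exists n, 0%N; rewrite subr0|exists 0%N, n.+1; rewrite sub0r NegzE].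
have fC i j : commute (f ^+ i)%g (f ^- j)%g.
  by apply/commuteV/commuteX2/commute_refl.
move=> [m _ <-] [n _ <-]; have [i [j ->]] := intE m; have [a [b ->]] := intE n.
exists ((i + b)%N%:Z - (a + j)%N%:Z) => //.
rewrite !zpow_sub invgM invgK !expgnDr invgM.
by rewrite -!mulgA; congr (_ * _)%g; rewrite !mulgA (fC b j).
Qed.

End CyclicSubgroup.

(** * From linear growth along powers to a quasi-isometric embedding *)

Section LinearGrowth.
Variables (R : realType) (G : groupTopType) (d : G -> G -> R) (f : G).
Hypothesis maxd : maximal_pseudometric d.

Let d_refl x : d x x = 0. Proof. by case: maxd => -[[]]. Qed.
Let d_sym x y : d x y = d y x. Proof. by case: maxd => -[[]]. Qed.
Let d_tri x y z : d x z <= d x y + d y z. Proof. by case: maxd => -[[]]. Qed.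
Let d_inv x y z : d (x * z)%g (y * z)%g = d x y. Proof. by case: maxd => -[[]]. Qed.
Let d_ge0 x y : 0 <= d x y.
Proof. by have := d_tri x y x; rewrite d_refl (d_sym y x); lra. Qed.

Let d_expg n : d (f ^+ n)%g 1%g <= n%:R * d f 1%g.
Proof.
elim: n => [|n IH]; first by rewrite d_refl mul0r.
rewrite (le_trans (d_tri _ (f ^+ n)%g _))// expgS -natr1 mulrDl mul1r addrC.
by rewrite lerD// -{2}[(f ^+ n)%g]mul1g d_inv.
Qed.

Let d_zpow m : d (zpow f m) 1%g = d (f ^+ `|m|)%g 1%g.
Proof.
case: m => // n; rewrite /= d_sym -(d_inv _ _ (f ^+ n.+1)%g).
by rewrite mulVg mul1g.
Qed.

(** Along the powers of [f], [d] is at most linear by subadditivity and at least linear because it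
    dominates [rho]; exponents that are not multiples of [q] cost only a bounded error. *)
Lemma linear_growth_undistorted (rho : G -> G -> R) (q : nat) (c : R) :
  continuous_right_invariant_pseudometric rho -> (0 < q)%N -> 0 < c ->
  (forall n, c * n%:R <= rho (f ^+ (q * n))%g 1%g) ->
  Ck_undistorted d f.
Proof.
move=> rhoP q0 c0 rho_ge; case.
  apply; have [K0 [C0 dKC]] := maxd.2 rho rhoP.
  (* Maximality gives constants of unknown sign; since [d] is nonnegative they may be enlarged. *)
  pose K := Num.max K0 1; pose C := `|C0|; pose L := d f 1%g.
  have K1 : 1 <= K by rewrite le_max lexx orbT.
  have dK x y : rho x y <= K * d x y + C.
    rewrite (le_trans (dKC x y))// lerD ?ler_norm// ler_wpM2r//.
    by rewrite le_max lexx.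
  have L0 : 0 <= L by exact: d_ge0.
  have q0' : 0 < q%:R :> R by rewrite ltr0n.
  (* Write n = q a + r with r < q. By right invariance, [f ^+ n] and [f ^+ (q * a)] are as far apart
     as [f ^+ r] and 1, hence within q L. *)
  have lower n : c * n%:R <= (q%:R * K) * d (f ^+ n)%g 1%g
      + (q%:R * K * (q%:R * L) + q%:R * C + c * q%:R).
    have qn := divn_eq n q; set a := (n %/ q)%N in qn; set r := (n %% q)%N in qn.
    have rq : (r < q)%N by rewrite ltn_mod.
    have h1 := le_trans (rho_ge a) (dK _ _).
    have h2 : d (f ^+ (q * a))%g 1%g <= d (f ^+ n)%g 1%g + q%:R * L.
      rewrite (le_trans (d_tri _ (f ^+ n)%g _))// addrC lerD2l d_sym.
      rewrite qn addnC mulnC expgnDr -{2}[(f ^+ (q * a))%g]mul1g d_inv.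
      by rewrite (le_trans (d_expg _))// ler_wpM2r// ler_nat ltnW.
    have h3 : n%:R <= q%:R * a%:R + q%:R :> R.
      by rewrite -natrM -natrD ler_nat qn mulnC leq_add2l ltnW.
    have h4 := ler_wpM2l (ltW c0) h3.
    have K0' : 0 <= K by lra.
    have h5 := ler_wpM2l K0' h2.
    have h6 : c * a%:R <= K * (d (f ^+ n)%g 1%g + q%:R * L) + C by lra.
    have h7 := ler_wpM2l (ltW q0') h6.
    by lra.
  pose A : R := q%:R * K / c; pose B := (q%:R * K * (q%:R * L) + q%:R * C + c * q%:R) / c.
  have A0 : 0 <= A by rewrite divr_ge0 ?mulr_ge0//; lra.
  have C0' : 0 <= C by exact: normr_ge0.
  have B0 : 0 <= B.
    by rewrite divr_ge0 ?addr_ge0 ?mulr_ge0//; lra.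
  have lowerAB n : n%:R <= A * d (f ^+ n)%g 1%g + B.
    rewrite -(ler_pM2l c0) (le_trans (lower n))// mulrDr /A /B.
    by rewrite ![_ / c * _]mulrAC !(mulrC c) !divfK ?gt_eqF.
  (* One constant has to serve both inequalities: the lower one needs A <= M, the upper one L <=
     M. *)
  pose M : R := 1 + A + L.
  have [M1 AM LM] : [/\ 1 <= M, A <= M & L <= M] by rewrite /M; split; lra.
  have M0 : 0 < M by lra.
  exists M, B; split => // -[x Gx] [y Gy] /=.
  rewrite /set_val /=.
  have [m0 _ m0E] := cyclic_subgroup_div (set_mem Gx) (set_mem Gy).
  set S := (X in _ * inf X - _ <= _ <= _).
  (* Every exponent representing x y^-1 gives the same distance, so the estimates can be made
     exponent by exponent. *)
  have dxy m : zpow f m = (x * y^-1)%g -> d x y = d (f ^+ `|m|)%g 1%g.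
    by move=> mE; rewrite -d_zpow mE -(d_inv x y y^-1) mulgV.
  have S0 : S `|m0|%N%:R by exists m0.
  apply/andP; split.
    have infS : inf S <= `|m0|%N%:R.
      by apply: ge_inf => //; exists 0 => _ [m _ <-].
    have : inf S <= M * (d x y + B).
      rewrite (le_trans infS)// (le_trans (lowerAB _))// (dxy _ m0E) mulrDr.
      by rewrite lerD ?ler_wpM2r ?ler_peMl ?d_ge0.
    by rewrite -ler_pdivrMl// => ?; rewrite lerBlDr.
  (* Rather than showing that the infimum is attained, bound every element of [S] from below. *)
  have : d x y / M <= inf S.
    apply: lb_le_inf; first by exists `|m0|%N%:R.
    move=> _ [m mE <-]; rewrite ler_pdivrMr// (dxy _ mE).
    by rewrite (le_trans (d_expg _))// ler_wpM2l.
  by rewrite ler_pdivrMr// mulrC => /le_trans; apply; rewrite lerDl.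
(* Torsion would make [rho] vanish at [f ^+ (q * n)], against the lower bound c n > 0. *)
move=> [n n0 fn1].
have := rho_ge n; rewrite mulnC expgnA fn1 expg1n.
by case: rhoP => -[-> _ _] _ _; rewrite leNgt mulr_gt0 ?ltr0n.
Qed.

End LinearGrowth.

(** * The supremum pseudometric of a bounded additive cocycle *)

Section AdditiveCocycle.
Variables (R : realType) (G : groupTopType) (X : Type) (act : G -> X -> X).
Variables (L : G -> X -> R) (x0 : X).
Hypothesis act1 : forall x, act 1%g x = x.
Hypothesis actM : forall g h x, act (g * h)%g x = act g (act h x).
Hypothesis LM : forall g h x, L (g * h)%g x = L g (act h x) + L h x.
Hypothesis L_bounded : forall g, exists M : R, forall x, `|L g x| <= M.
Hypothesis L_near : forall g (e : R), 0 < e ->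
  \forall h \near g, forall x, `|L g x - L h x| <= e.

Definition sup_dist (g h : G) : R := sup (range (fun x => `|L g x - L h x|)).

(** Boundedness of the cocycle makes [sup] a true supremum here. *)
Lemma sup_dist_ge g h x : `|L g x - L h x| <= sup_dist g h.
Proof.
have [M gM] := L_bounded g; have [N hN] := L_bounded h.
apply: ub_le_sup; last by exists x.
exists (M + N) => _ [y _ <-].
by rewrite (le_trans (ler_normB _ _))// lerD.
Qed.

Lemma sup_dist_le g h e : (forall x, `|L g x - L h x| <= e) -> sup_dist g h <= e.
Proof.
move=> gh; apply: ge_sup; first by exists `|L g x0 - L h x0|, x0.
by move=> _ [x _ <-].
Qed.

Lemma sup_dist_pseudometric : is_pseudometric sup_dist.
Proof.
split=> [g|g h|g h k].
- apply/eqP; rewrite eq_le sup_dist_le => [|x]; last by rewrite subrr normr0.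
  by rewrite (le_trans _ (sup_dist_ge g g x0)).
- by apply/eqP; rewrite eq_le !sup_dist_le// => x; rewrite distrC sup_dist_ge.
- apply: sup_dist_le => x; rewrite (le_trans (ler_distD (L h x) _ _))//.
  by rewrite lerD// sup_dist_ge.
Qed.

Lemma sup_dist_right_invariant : right_invariant sup_dist.
Proof.
move=> g h k; apply/eqP; rewrite eq_le; apply/andP; split.
  apply: sup_dist_le => x; rewrite !LM opprD addrACA subrr addr0.
  exact: sup_dist_ge.
(* [act k] is onto, so translating by [k] loses no points of the supremum. *)
apply: sup_dist_le => x; have -> : x = act k (act k^-1%g x).
  by rewrite -actM mulgV act1.
rewrite (le_trans _ (sup_dist_ge _ _ (act k^-1%g x)))// !LM.
by rewrite opprD addrACA subrr addr0.
Qed.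

(** By the triangle inequality the value moves by at most the sum of the displacements of both
    arguments, each at most e / 2 on a neighbourhood from [L_near]. *)
Lemma sup_dist_continuous : continuous (fun gh : G * G => sup_dist gh.1 gh.2).
Proof.
have [_ sym tri] := sup_dist_pseudometric.
move=> [g h]; apply/cvgrPdist_le => e e0 /=.
have e2 : 0 < e / 2 by rewrite divr_gt0.
exists ([set g' | forall x, `|L g x - L g' x| <= e / 2],
        [set h' | forall x, `|L h x - L h' x| <= e / 2]) => /=.
  by split; exact: L_near.
move=> [g' h'] [/= /sup_dist_le gg' /sup_dist_le hh'].
have := tri g g' h; have := tri g' h' h; have := tri g' g h'.
have := tri g h h'; rewrite (sym g' g) (sym h' h) => ? ? ? ?.
by rewrite ler_norml; apply/andP; split; lra.
Qed.

(** On the stabilizer of a point the cocycle identity becomes additivity. *)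
Lemma cocycle_fixed_point_expg (f : G) x n :
  act f x = x -> L (f ^+ n)%g x = n%:R * L f x.
Proof.
move=> fx; have L1 : L 1%g x = 0.
  by have /eqP := LM 1 1 x; rewrite mulg1 act1 -subr_eq0 opprD addNKr oppr_eq0 => /eqP.
elim: n => [|n IH]; first by rewrite L1 mul0r.
by rewrite expgSr LM fx IH -natr1 mulrDl mul1r.
Qed.

Lemma cocycle_undistorted (d : G -> G -> R) (f : G) q x :
  maximal_pseudometric d -> (0 < q)%N -> act (f ^+ q)%g x = x ->
  L (f ^+ q)%g x != 0 -> Ck_undistorted d f.
Proof.
move=> maxd q0 fqx Lq.
apply: (@linear_growth_undistorted _ _ _ _ maxd sup_dist q `|L (f ^+ q)%g x|) => //.
- split; [exact: sup_dist_pseudometric|exact: sup_dist_continuous|].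
  exact: sup_dist_right_invariant.
- by rewrite normr_gt0.
- move=> n; rewrite expgnA (le_trans _ (sup_dist_ge _ _ x))//.
  rewrite (cocycle_fixed_point_expg n fqx).
  (* The zeroth power of 1 yields L 1 x = 0. *)
  rewrite (@cocycle_fixed_point_expg 1%g x 0) ?act1// mul0r subr0.
  by rewrite normrM normr_nat mulrC.
Qed.

End AdditiveCocycle.

(** * Logarithms of multiplicative cocycles *)

Lemma ln_sub_le (R : realType) (a b m e : R) : 0 < m -> m <= a -> m <= b ->
  `|a - b| <= m * e -> `|ln a - ln b| <= e.
Proof.
wlog ab : a b / b <= a => [H|m0 _ mb].
  have [|/ltW ab] := leP b a; first exact: H.
  by move=> m0 ma mb; rewrite distrC [`|ln _ - _|]distrC; exact: H.
have b0 : 0 < b by exact: lt_le_trans mb.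
have a0 : 0 < a by exact: lt_le_trans ab.
rewrite ger0_norm ?subr_ge0// ger0_norm ?subr_ge0 ?ler_ln ?posrE// => abe.
(* Use ln (1 + u) <= u with u = (a - b) / b, which is at most e because m <= b. *)
rewrite -ln_div ?posrE// -[_ / _](subrKC 1).
have -> : a / b - 1 = (a - b) / b by rewrite mulrBl divff ?gt_eqF.
have ab0 : 0 <= (a - b) / b by rewrite divr_ge0 ?subr_ge0// ltW.
rewrite (le_trans (le_ln1Dx _))//; first by rewrite (lt_le_trans _ ab0)// ltrN10.
rewrite ler_pdivrMr// (le_trans abe)// mulrC ler_wpM2l//.
(* [e] is nonnegative because 0 <= a - b <= m e. *)
by rewrite -(ler_pM2l m0) mulr0 (le_trans _ abe)// subr_ge0//.
Qed.

Section MultiplicativeCocycle.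
Variables (R : realType) (G : groupTopType) (X : Type) (act : G -> X -> X).
Variables (D : G -> X -> R).
Hypothesis act1 : forall x, act 1%g x = x.
Hypothesis actM : forall g h x, act (g * h)%g x = act g (act h x).
Hypothesis D1 : forall x, D 1%g x = 1.
Hypothesis DM : forall g h x, D (g * h)%g x = D g (act h x) * D h x.
Hypothesis D_ge0 : forall g x, 0 <= D g x.
Hypothesis D_bounded : forall g, exists M : R, forall x, D g x <= M.
Hypothesis D_near : forall g (e : R), 0 < e ->
  \forall h \near g, forall x, `|D g x - D h x| < e.

Lemma mul_cocycleV g x : D g^-1%g (act g x) * D g x = 1.
Proof. by rewrite -DM mulVg D1. Qed.

(** The value at the inverse element is a multiplicative inverse, which excludes zero. *)
Lemma mul_cocycle_gt0 g x : 0 < D g x.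
Proof.
rewrite lt_neqAle D_ge0 andbT eq_sym; apply/eqP => Dg0.
by have /eqP := mul_cocycleV g x; rewrite Dg0 mulr0 eq_sym oner_eq0.
Qed.

(** An upper bound for the cocycle of the inverse inverts to a lower bound for [g]; the maximum with
    1 keeps it positive. *)
Lemma mul_cocycle_lower_bound g : exists2 m, 0 < m & forall x, m <= D g x.
Proof.
have [M gM] := D_bounded g^-1%g; exists (Num.max M 1)^-1 => [|x].
  by rewrite invr_gt0 lt_max ltr01 orbT.
have M0 : 0 < Num.max M 1 by rewrite lt_max ltr01 orbT.
rewrite -(ler_pM2l M0) divff ?gt_eqF// -(mul_cocycleV g x).
by rewrite ler_wpM2r// (le_trans (gM _))// le_max lexx.
Qed.

Lemma mul_cocycle_undistorted (d : G -> G -> R) (f : G) q x :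
  maximal_pseudometric d -> (0 < q)%N -> act (f ^+ q)%g x = x ->
  D (f ^+ q)%g x != 1 -> Ck_undistorted d f.
Proof.
move=> maxd q0 fqx Dq; have D0 := mul_cocycle_gt0.
apply: (@cocycle_undistorted _ _ _ act (fun g x => ln (D g x)) x _ _ _ _ _ _ _ q x) => //.
- by move=> g h y; rewrite DM lnM ?posrE.
- move=> g; have [M gM] := D_bounded g; have [m m0 gm] := mul_cocycle_lower_bound g.
  exists (`|ln M| + `|ln m|) => y.
  have : ln m <= ln (D g y) by rewrite ler_ln ?posrE.
  have : ln (D g y) <= ln M by rewrite ler_ln ?posrE// (lt_le_trans (D0 g y)).
  have := ler_norm (ln M); have := ler_norm (- ln m); rewrite normrN => ? ? ? ?.
  have := normr_ge0 (ln M); have := normr_ge0 (ln m) => ? ?.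
  by rewrite ler_norml; apply/andP; split; lra.
- move=> g e e0; have [m m0 gm] := mul_cocycle_lower_bound g.
  have m20 : 0 < m / 2 by rewrite divr_gt0.
  (* The factor at most 1 keeps [D h] above m / 2; the factor at most e then gives the bound through
     [ln_sub_le] with constant m / 2. *)
  have me0 : 0 < m / 2 * Num.min e 1 by rewrite mulr_gt0// lt_min e0 ltr01.
  apply: filterS (D_near g me0) => h gh y.
  have me : m / 2 * Num.min e 1 <= m / 2 * e by rewrite ler_wpM2l ?ge_min ?lexx// ltW.
  have m1 : m / 2 * Num.min e 1 <= m / 2 by rewrite ler_piMr ?ge_min ?lexx ?orbT// ltW.
  apply: (@ln_sub_le _ _ _ (m / 2)) => //.
  + by rewrite (le_trans _ (gm y))//; lra.
  + have := gh y; have := gm y; rewrite ltr_norml => ? /andP[? ?]; lra.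
  + by rewrite (le_trans (ltW (gh y))).
- by rewrite ln_eq0.
Qed.

End MultiplicativeCocycle.

(** * Sign and continuity of derivatives relative to a set *)

Section DerivOnFacts.
Variables (R : realType) (A : set R).

Lemma deriv_on_ge0 (f : R -> R) (x : R) : ProperFilter (within A x^') -> A x ->
  {in A &, {homo f : s t / s <= t}} -> derivable_on A f x -> 0 <= deriv_on A f x.
Proof.
move=> PA Ax f_homo [l fl]; apply: limr_ge; first by apply/cvg_ex; exists l.
near=> y.
have Ay : y \in A by rewrite inE; near: y; exact: withinT.
have Ax' : x \in A by rewrite inE.
have [xy|/ltW yx] := leP x y.
  by rewrite divr_ge0 ?subr_ge0// f_homo.
by rewrite -mulrNN -invrN !opprB divr_ge0 ?subr_ge0// f_homo.
Unshelve. all: by end_near. Qed.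

Lemma Ck_on_deriv (k : nat) (f : R -> R) :
  (forall x, A x -> ProperFilter (within A x^')) -> (0 < k)%N -> Ck_on A k f ->
  (forall x, A x -> is_deriv_on A f x (deriv_on A f x)) /\
  {within A, continuous (deriv_on A f)}.
Proof.
case: k => // k A_perfect _ /Ck_onS[df cf]; split=> [x Ax|].
  by apply: deriv_onP => //; exact: df.
exact: Ck_on_continuous cf.
Qed.

End DerivOnFacts.

(** * Computing circle derivatives through an arbitrary lift *)

Section CircleDerivative.
Variable R : realType.
Implicit Types (f g : circle R -> circle R) (F : R -> R).

Lemma is_lift_addz F f (m : R) : m \is a Num.int -> is_lift F f ->
  is_lift (fun t => F t + m) f.
Proof.
move=> mZ [cF Ff]; split=> [t|t].
  by apply: cvgD; [exact: cF|exact: cvg_cst].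
by rewrite Ff; apply/pi_circleP; rewrite opprD addNKr rpredN.
Qed.

Lemma is_lift_shift F f (m : R) : m \is a Num.int -> is_lift F f ->
  is_lift (fun t => F (t + m)) f.
Proof.
move=> mZ Ff; have := is_lift_comp Ff (is_lift_addz mZ (@is_lift_id R)).
by congr is_lift.
Qed.

(** Changing the lift or the representative only adds integer constants after or before [F], and
    these do not affect the derivative. This frees later proofs from the choices made by
    [circle_lift] and [repr]. *)
Lemma deriv_circle1E F f (t l : R) : is_lift F f -> is_deriv_on setT F t l ->
  deriv_circle 1 f (\pi_(circle R) t) = l.
Proof.
move=> Ff Fl; rewrite /deriv_circle derive1n1 -deriv_onT.
set r := repr _; have rt : r - t \is a Num.int by apply/pi_circleP; rewrite reprK.
have tr : t - r \is a Num.int by rewrite -opprB rpredN.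
have Gf : is_lift (circle_lift f) f by apply: (@getPex _ [set F | is_lift F f]); exists F.
have [m GE] := is_lift_unique Gf (is_lift_shift tr Ff).
apply: deriv_onE => //; first exact: setT_perfect.
apply: (@is_deriv_on_ext _ _ (fun u => F (u + (t - r)) + m%:~R)) => //.
rewrite -[l]addr0; apply: is_deriv_onD; last exact: is_deriv_on_cst.
rewrite -[l]mulr1; apply: (@is_deriv_on_comp _ setT F) => //.
  by rewrite subrKC.
by rewrite -[1]addr0; apply: is_deriv_onD; [exact: is_deriv_on_id|exact: is_deriv_on_cst].
Qed.

End CircleDerivative.

(** * The derivative cocycle on the circle *)

Section CircleUndistorted.
Variables (R : realType) (k : nat).
Hypothesis k0 : (0 < k)%N.
Implicit Types f g : diffeo_circle R k.

Lemma diffeo_circle_lift f : exists F, [/\ is_lift F f,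
  forall t, is_deriv_on setT F t (deriv_on setT F t) &
  {within setT, continuous (deriv_on setT F)}].
Proof.
have [F Ff /(Ck_on_deriv (@setT_perfect R) k0)[dF cF]] := circle_fun_Ck f.
by exists F; split=> // t; exact: dF.
Qed.

Lemma deriv_circle_id x : deriv_circle 1 (1%g : diffeo_circle R k) x = 1.
Proof.
rewrite -[x]reprK; apply: (deriv_circle1E (@is_lift_id R)).
exact: is_deriv_on_id.
Qed.

Lemma deriv_circle_mul f g x :
  deriv_circle 1 (f * g)%g x = deriv_circle 1 f (g x) * deriv_circle 1 g x.
Proof.
have [F [Ff dF _]] := diffeo_circle_lift f.
have [G [Gg dG _]] := diffeo_circle_lift g.
rewrite -[x]reprK Gg.2 (deriv_circle1E Ff (dF _)) (deriv_circle1E Gg (dG _)).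
apply: (deriv_circle1E (is_lift_comp Ff Gg)).
exact: is_deriv_on_comp.
Qed.

Lemma deriv_circle_ge0 f x : 0 <= deriv_circle 1 f x.
Proof.
have [F [Ff dF _]] := diffeo_circle_lift f.
have [F' Ff' F'_homo] := circle_fun_or f.
have [m FE] := is_lift_unique Ff Ff'.
rewrite -[x]reprK (deriv_circle1E Ff (dF _)); apply: deriv_on_ge0 => //.
- exact: setT_perfect.
- by move=> s t _ _; rewrite !FE lerD2r; apply: ltW_homo.
- by exists (deriv_on setT F (repr x)).
Qed.

Lemma deriv_circle_bounded f : exists M, forall x, deriv_circle 1 f x <= M.
Proof.
have [F [Ff dF cF]] := diffeo_circle_lift f.
have [|c _ cM] := @EVT_max R (deriv_on setT F) 0 1 ler01.
  exact: continuous_subspaceW cF.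
(* Fractional parts represent all points of the circle, so the maximum over [0, 1] bounds every
   value. *)
exists (deriv_on setT F c) => x; set t : R := repr x - (Num.floor (repr x))%:~R.
have -> : x = \pi_(circle R) t.
  rewrite -[LHS]reprK; apply/pi_circleP; rewrite /t subKr.
  exact: rpred_int.
rewrite (deriv_circle1E Ff (dF _)) cM// in_itv/= /t subr_ge0 lerBlDl.
by have /andP[-> /ltW] := floor_itv (repr x); rewrite intrD.
Qed.

Lemma hyperbolic_periodic_point_undistorted
    (d : diffeo_circle R k -> diffeo_circle R k -> R) f x :
  maximal_pseudometric d -> hyperbolic_periodic_point f x -> Ck_undistorted d f.
Proof.
move=> maxd [q [q0 fqx Dfqx]].
apply: (@mul_cocycle_undistorted _ _ _ (fun g x => g x)
  (fun g x => deriv_circle 1 g x) _ _ _ _ _ _ _ _ _ q x) => //.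
- exact: deriv_circle_id.
- exact: deriv_circle_mul.
- exact: deriv_circle_ge0.
- exact: deriv_circle_bounded.
(* Uniform closeness of first derivatives is the case j = 1 of the ball, available because k >=
   1. *)
- move=> g e e0; apply: filterS (nbhsx_ballx g e e0) => h [_ gh] y.
  by apply: gh; rewrite ltnS.
Qed.

End CircleUndistorted.

(** * The derivative cocycle on the interval *)

Section IntervalUndistorted.
Variables (R : realType) (k : nat).
Hypothesis k0 : (0 < k)%N.
Implicit Types (f g : diffeo_interval R k) (x : unit_interval R).

Let unit_itv_val x : `[0, 1]%classic (\val x).
Proof. by rewrite /= in_itv/=; exact: (valP x). Qed.

Let extend_val f x : extend f (\val x) = \val (f x).
Proof. by rewrite /extend valKd. Qed.

Lemma diffeo_interval_deriv f x :
  is_deriv_on `[0, 1] (extend f) (\val x) (deriv_interval 1 f x).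
Proof.
have [df _] := Ck_on_deriv (@unit_itv_perfect R) k0 (interval_fun_Ck f).
exact: df.
Qed.

Lemma deriv_interval_id x : deriv_interval 1 (1%g : diffeo_interval R k) x = 1.
Proof.
apply: (deriv_onE (@unit_itv_perfect R)) => //.
apply: is_deriv_on_ext (is_deriv_on_id _ _) => // y.
by rewrite inE/= in_itv/= => y01; rewrite /extend insubdK.
Qed.

Lemma deriv_interval_mul f g x :
  deriv_interval 1 (f * g)%g x = deriv_interval 1 f (g x) * deriv_interval 1 g x.
Proof.
apply: (deriv_onE (@unit_itv_perfect R)) => //.
rewrite [extend _]extend_comp; apply: is_deriv_on_comp.
- by move=> y _; exact: unit_itv_val.
- by rewrite extend_val; exact: diffeo_interval_deriv.
- exact: diffeo_interval_deriv.
Qed.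

Lemma deriv_interval_ge0 f x : 0 <= deriv_interval 1 f x.
Proof.
apply: deriv_on_ge0 => //.
- exact: unit_itv_perfect.
- move=> s t; rewrite !inE /= !in_itv/= => s01 t01.
  rewrite le_eqVlt => /orP[/eqP->//|st]; apply/ltW/interval_fun_or.
  by rewrite !insubdK.
- by exists (deriv_interval 1 f x); exact: diffeo_interval_deriv.
Qed.

Lemma deriv_interval_bounded f : exists M, forall x, deriv_interval 1 f x <= M.
Proof.
have [_ cf] := Ck_on_deriv (@unit_itv_perfect R) k0 (interval_fun_Ck f).
have [c _ cM] := EVT_max ler01 cf.
by exists (deriv_on `[0, 1] (extend f) c) => x; apply: cM; exact: unit_itv_val.
Qed.

Lemma hyperbolic_fixed_point_undistorted
    (d : diffeo_interval R k -> diffeo_interval R k -> R) f x :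
  maximal_pseudometric d -> hyperbolic_fixed_point f x -> Ck_undistorted d f.
Proof.
move=> maxd [fx Dfx].
(* A fixed point is treated as a periodic point of period 1. *)
apply: (@mul_cocycle_undistorted _ _ _ (fun g x => g x)
  (fun g x => deriv_interval 1 g x) _ _ _ _ _ _ _ _ _ 1 x) => //.
- exact: deriv_interval_id.
- exact: deriv_interval_mul.
- exact: deriv_interval_ge0.
- exact: deriv_interval_bounded.
- move=> g e e0; apply: filterS (nbhsx_ballx g e e0) => h gh y.
  exact: gh.
Qed.

End IntervalUndistorted.

Theorem corollary1p2 (R : realType) (k : nat) (hk : (1 <= k)%N) :
  (forall (d : diffeo_circle R k -> diffeo_circle R k -> R)
     (f : diffeo_circle R k),
     maximal_pseudometric d ->
     (exists x : circle R, hyperbolic_periodic_point f x) ->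
     Ck_undistorted d f) /\
  (forall (d : diffeo_interval R k -> diffeo_interval R k -> R)
     (f : diffeo_interval R k),
     maximal_pseudometric d ->
     (exists x : unit_interval R, hyperbolic_fixed_point f x) ->
     Ck_undistorted d f).
Proof.
split=> d f maxd [x fx].
- exact: hyperbolic_periodic_point_undistorted maxd fx.
- exact: hyperbolic_fixed_point_undistorted maxd fx.
Qed.
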